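(* There exists a planar triconnected graph of maximum degree $4$ that is not outer-RAC.
   Context: A drawing is straight-line if each edge is a line segment; an outer-RAC drawing is a straight-line drawing in which every crossing occurs at a right angle and every vertex is incident to the unbounded cell of the plane minus the drawing. A graph is outer-RAC if it admits an outer-RAC drawing. *)

(* Defs.v *)
(* MathComp / MathComp-Analysis. *)
From mathcomp Require Import all_boot all_order all_algebra.
From mathcomp Require Import all_classical all_reals all_analysis.

Set Implicit Arguments.
Unset Strict Implicit.
Unset Printing Implicit Defensive.

Import Order.TTheory GRing.Theory Num.Theory.
Import numFieldNormedType.Exports.

Local Open Scope classical_set_scope.
Local Open Scope ring_scope.

Record sgraph := SGraph {
  vertex :> finType;
  adj : rel vertex;
  adj_sym : symmetric adj;
  adj_irrefl : irreflexive adj }.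

Definition degree (G : sgraph) (v : G) : nat := #|[set w : G | adj v w]%SET|.

Definition max_degree (G : sgraph) : nat := (\max_(v : G) degree v)%N.

Definition adj_avoiding (G : sgraph) (S : {set G}) : rel G :=
  [rel x y | [&& x \notin S, y \notin S & adj x y]].

Definition k_connected (k : nat) (G : sgraph) : Prop :=
  (k < #|G|)%N /\
  forall S : {set G}, (#|S| < k)%N ->
  forall x y : G, x \notin S -> y \notin S -> connect (adj_avoiding S) x y.

Definition triconnected (G : sgraph) : Prop := k_connected 3 G.

(* [R^o] rather than [R], so that the product carries the normed module
   structure (and its topology). *)
Notation plane R := (R^o * R^o)%type.

Definition dot (R : realType) (p q : plane R) : R := p.1 * q.1 + p.2 * q.2.

Definition segment (R : realType) (p q : plane R) : set (plane R) :=
  [set (1 - t) *: p + t *: q | t in `[(0 : R), 1]].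

Definition simple_arc (R : realType) (p q : plane R) (A : set (plane R)) : Prop :=
  exists f : R -> plane R,
    [/\ {within `[0, 1], continuous f},
        {in `[0, 1]%R &, injective f},
        f 0 = p, f 1 = q & A = f @` `[0, 1]].

(* [curve u v] is only meaningful when [u] and [v] are adjacent. [curve_vertex]
   is the usual convention that an edge meets no vertex besides its ends; for
   line segments it also excludes overlapping edges. *)
Record drawing (R : realType) (G : sgraph) := Drawing {
  pos : G -> plane R;
  curve : G -> G -> set (plane R);
  pos_inj : injective pos;
  curve_sym : forall u v, adj u v -> curve u v = curve v u;
  curve_arc : forall u v, adj u v -> simple_arc (pos u) (pos v) (curve u v);
  curve_vertex : forall u v w, adj u v -> curve u v (pos w) -> w = u \/ w = v }.

(* Edges may share an end; such a common vertex is not a crossing. *)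
Definition crossing (R : realType) (G : sgraph) (d : drawing R G)
    (u v x y : G) (p : plane R) : Prop :=
  [/\ adj u v, adj x y, [set u; v]%SET != [set x; y]%SET,
      curve d u v p /\ curve d x y p & forall w, p <> pos d w].

Definition planar (R : realType) (G : sgraph) : Prop :=
  exists d : drawing R G, forall u v x y p, ~ crossing d u v x y p.

Definition straight_line (R : realType) (G : sgraph) (d : drawing R G) : Prop :=
  forall u v, adj u v -> curve d u v = segment (pos d u) (pos d v).

(* Only used for straight-line drawings, where the angle at a crossing is the
   angle between the directions of the two edges. *)
Definition right_angle_crossings (R : realType) (G : sgraph)
    (d : drawing R G) : Prop :=
  forall u v x y p, crossing d u v x y p ->
    dot (pos d v - pos d u) (pos d y - pos d x) = 0.

Definition drawing_set (R : realType) (G : sgraph)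
    (d : drawing R G) : set (plane R) :=
  range (pos d) `|` [set p | exists u v, adj u v /\ curve d u v p].

Definition cell (R : realType) (G : sgraph) (d : drawing R G)
    (C : set (plane R)) : Prop :=
  exists2 z, (~` drawing_set d) z & C = connected_component (~` drawing_set d) z.

(* [drawing_set d] is compact, so there is exactly one unbounded cell. *)
Definition outer (R : realType) (G : sgraph) (d : drawing R G) : Prop :=
  exists C : set (plane R),
    [/\ cell d C, ~ bounded_set C & forall v, closure C (pos d v)].

Definition outer_RAC (R : realType) (G : sgraph) : Prop :=
  exists d : drawing R G,
    [/\ straight_line d, right_angle_crossings d & outer d].

(* Main.v *)
(** The witness is the octahedron [K_{2,2,2}].  No vertex of an outer drawing
    lies in a triangle of the graph, and an edge with right-angle crossings
    cannot cross two sides of a triangle; so an edge crossing the side [bc] of a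
    triangle [abc] must end at [a].  In the octahedron each edge lies in two
    triangles, whose apexes are antipodal, hence not adjacent: there are no
    crossings at all, and the two apexes lie on opposite sides of the common
    edge.  The eight faces, oriented as the boundary of the octahedron, would
    therefore all have signed area of the same strict sign, but the signed areas
    of a closed surface add up to zero. *)
Require Import Defs.
From mathcomp Require Import all_boot all_order all_algebra.
From mathcomp Require Import all_classical all_reals all_analysis.
From mathcomp Require Import ring lra.

Set Implicit Arguments.
Unset Strict Implicit.
Unset Printing Implicit Defensive.

Import Order.TTheory GRing.Theory Num.Theory.
Import numFieldNormedType.Exports.

Local Open Scope classical_set_scope.
Local Open Scope ring_scope.

(** * Signed areas, barycentric coordinates and triangles in the plane *)

(** Twice the signed area of the triangle [abc]. *)
Definition cross (R : realType) (a b c : plane R) : R :=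
  (b.1 - a.1) * (c.2 - a.2) - (b.2 - a.2) * (c.1 - a.1).

Lemma cross_cyclic (R : realType) (a b c : plane R) : cross b c a = cross a b c.
Proof. by rewrite /cross; ring. Qed.

(** Cramer's rule: each coordinate is the signed area with [z] put in place of a vertex, divided by
    the whole area. *)
Lemma barycentric (R : realType) (a b c z : plane R) : cross a b c != 0 ->
  exists k : R * R * R, [/\ k.1.1 + k.1.2 + k.2 = 1,
    z = k.1.1 *: a + k.1.2 *: b + k.2 *: c,
    cross z b c = k.1.1 * cross a b c,
    cross a z c = k.1.2 * cross a b c &
    cross a b z = k.2 * cross a b c].
Proof.
move=> D0; exists (cross z b c / cross a b c, cross a z c / cross a b c,
  cross a b z / cross a b c); rewrite /= !divfK //; split=> //.
  by rewrite -!mulrDl; apply: (canLR (mulfK D0)); rewrite mul1r /cross; ring.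
case: z D0 => z1 z2; rewrite /cross => D0.
by congr pair; rewrite /= /GRing.scale /=; field.
Qed.

Lemma cross_continuous (R : realType) (a b : plane R) (D : R) :
  continuous (fun z : plane R => cross a b z * D : R^o).
Proof.
move=> z; apply: cvgM; last exact: cvg_cst.
apply: cvgB; apply: cvgM; try exact: cvg_cst; apply: cvgB; try exact: cvg_cst.
  exact: cvg_snd.
exact: cvg_fst.
Qed.

Lemma closed_half_plane (R : realType) (a b : plane R) (D : R) :
  closed [set z : plane R | 0 <= cross a b z * D].
Proof.
rewrite -[X in closed X]/((fun z : plane R => cross a b z * D : R^o) @^-1`
  [set x | 0 <= x]).
apply: preimage_closed; last exact: closed_ge.
by move=> z _; exact: cross_continuous.
Qed.

Lemma open_half_plane (R : realType) (a b : plane R) (D : R) :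
  open [set z : plane R | 0 < cross a b z * D].
Proof.
rewrite -[X in open X]/((fun z : plane R => cross a b z * D : R^o) @^-1`
  [set x | 0 < x]).
apply: open_comp; last exact: open_gt.
by move=> z _; exact: cross_continuous.
Qed.

(** The factor [cross a b c] makes the conditions independent of the orientation of the triangle. *)
Definition open_triangle (R : realType) (a b c : plane R) : set (plane R) :=
  [set z | [/\ 0 < cross z b c * cross a b c, 0 < cross a z c * cross a b c &
               0 < cross a b z * cross a b c]].

Definition closed_triangle (R : realType) (a b c : plane R) : set (plane R) :=
  [set z | [/\ 0 <= cross z b c * cross a b c, 0 <= cross a z c * cross a b c &
               0 <= cross a b z * cross a b c]].

Lemma open_open_triangle (R : realType) (a b c : plane R) :
  open (open_triangle a b c).
Proof.
have -> : open_triangle a b c =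
    [set z | 0 < cross b c z * cross a b c] `&`
    [set z | 0 < cross c a z * cross a b c] `&`
    [set z | 0 < cross a b z * cross a b c].
  apply/seteqP; split=> z /=.
    by case; rewrite -(cross_cyclic z b c) -(cross_cyclic a z c) -(cross_cyclic z c a).
  by case=> -[]; rewrite (cross_cyclic z b c) (cross_cyclic z c a) (cross_cyclic a z c).
by apply: openI; [apply: openI|]; exact: open_half_plane.
Qed.

Lemma closed_closed_triangle (R : realType) (a b c : plane R) :
  closed (closed_triangle a b c).
Proof.
have -> : closed_triangle a b c =
    [set z | 0 <= cross b c z * cross a b c] `&`
    [set z | 0 <= cross c a z * cross a b c] `&`
    [set z | 0 <= cross a b z * cross a b c].
  apply/seteqP; split=> z /=.
    by case; rewrite -(cross_cyclic z b c) -(cross_cyclic a z c) -(cross_cyclic z c a).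
  by case=> -[]; rewrite (cross_cyclic z b c) (cross_cyclic z c a) (cross_cyclic a z c).
by apply: closedI; [apply: closedI|]; exact: closed_half_plane.
Qed.

Lemma closed_triangle_convex_comb (R : realType) (a b c z : plane R) :
  cross a b c != 0 -> closed_triangle a b c z ->
  exists k : R * R * R,
    [/\ 0 <= k.1.1, 0 <= k.1.2, 0 <= k.2, k.1.1 + k.1.2 + k.2 = 1 &
        z = k.1.1 *: a + k.1.2 *: b + k.2 *: c].
Proof.
move=> D0; have [k [k1 zE ka kb kc]] := barycentric z D0.
have D2 : 0 < cross a b c * cross a b c by rewrite -expr2 exprn_even_gt0.
rewrite /closed_triangle /= ka kb kc -!mulrA !pmulr_lge0 // => -[? ? ?].
by exists k.
Qed.

(** A convex combination of [a], [b], [c] has norm at most [|a| + |b| + |c|]. *)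
Lemma bounded_closed_triangle (R : realType) (a b c : plane R) (C : set (plane R)) :
  cross a b c != 0 -> C `<=` closed_triangle a b c -> bounded_set C.
Proof.
move=> D0 CT; apply: filterS (nbhs_pinfty_ge (num_real (`|a| + `|b| + `|c|))).
move=> M /= leM z /CT /(closed_triangle_convex_comb D0) [[[x y] t] /= [x0 y0 t0 s1 ->]].
apply: le_trans leM; apply: le_trans (ler_normD _ _) _.
apply: lerD; first (apply: le_trans (ler_normD _ _) _; apply: lerD);
  rewrite normrZ ger0_norm //; apply: ler_piMl => //; lra.
Qed.

(** * Triangles of the graph in straight-line and outer drawings *)

Lemma curve_convex_comb (R : realType) (G : sgraph) (d : drawing R G) (u v : G)
    (s t : R) (z : plane R) :
  straight_line d -> adj u v -> 0 <= s -> 0 <= t -> s + t = 1 ->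
  z = s *: pos d u + t *: pos d v -> curve d u v z.
Proof.
move=> dS uv s0 t0 st ->; rewrite (dS _ _ uv); exists t; last first.
  by rewrite -st addrK.
by rewrite /= in_itv /=; apply/andP; split; lra.
Qed.

Lemma curveP (R : realType) (G : sgraph) (d : drawing R G) (u v : G) (z : plane R) :
  straight_line d -> adj u v -> curve d u v z ->
  exists k : R * R, [/\ 0 <= k.1, 0 <= k.2, k.1 + k.2 = 1 &
    z = k.1 *: pos d u + k.2 *: pos d v].
Proof.
move=> dS uv; rewrite (dS _ _ uv) => -[t /=]; rewrite in_itv /= => /andP[t0 t1] <-.
by exists (1 - t, t); split=> //=; lra.
Qed.

(** Of three collinear points one lies between the other two, so some side would contain the third
    vertex, against [curve_vertex]. *)
Lemma cross_triangle_neq0 (R : realType) (G : sgraph) (d : drawing R G) (a b c : G) :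
  straight_line d -> adj a b -> adj b c -> adj a c ->
  cross (pos d a) (pos d b) (pos d c) != 0.
Proof.
move=> dS ab bc ac; apply/eqP => D0.
have ne (x y : G) : adj x y -> x <> y by move=> xy e; rewrite e adj_irrefl in xy.
have nab : pos d a <> pos d b by move=> /pos_inj /ne; exact.
(* The parameter is read off a coordinate in which [a] and [b] differ. *)
have [t cE] : exists t, pos d c = (1 - t) *: pos d a + t *: pos d b.
  move: (pos d a) (pos d b) (pos d c) D0 nab => [a1 a2] [b1 b2] [c1 c2].
  rewrite /cross /= => D0 nab.
  have [e1|e1] := eqVneq a1 b1.
    have e2 : b2 - a2 != 0.
      by apply/eqP => e2; apply: nab; congr pair => //; lra.
    exists ((c2 - a2) / (b2 - a2)); congr pair; rewrite /= /GRing.scale /=.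
      rewrite -e1 in D0 *; have /eqP : (b2 - a2) * (c1 - a1) = 0 by lra.
      by rewrite mulf_eq0 (negPf e2) /= subr_eq0 => /eqP ->; ring.
    by field.
  have e2 : b1 - a1 != 0 by rewrite subr_eq0 eq_sym.
  exists ((c1 - a1) / (b1 - a1)); congr pair; rewrite /= /GRing.scale /=.
    by field.
  have : (b1 - a1) * c2 = (b1 - a1) * a2 + (b2 - a2) * (c1 - a1) by lra.
  by move=> /(canRL (mulKf e2)) ->; field.
have ba : adj b a by rewrite adj_sym.
have ca : adj c a by rewrite adj_sym.
have cb : adj c b by rewrite adj_sym.
have [t0|t0] := ltP t 0.
  have t1 : 1 - t != 0 by apply/eqP; lra.
  have : curve d b c (pos d a).
    (* The weights come from solving [cE] for [pos d a]; below, for [t > 1], it is solved for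
       [pos d b]. *)
    apply: (@curve_convex_comb _ _ _ _ _ (- t / (1 - t)) (1 / (1 - t))) => //.
    - by apply: divr_ge0; lra.
    - by apply: divr_ge0; lra.
    - by field.
    - rewrite cE; case: (pos d a) (pos d b) => a1 a2 [b1 b2].
      by congr pair; rewrite /= /GRing.scale /=; field.
  by case/(curve_vertex bc) => /ne; [apply|apply].
have [t1|t1] := ltP 1 t.
  have t2 : t != 0 by apply/eqP; lra.
  have : curve d a c (pos d b).
    apply: (@curve_convex_comb _ _ _ _ _ ((t - 1) / t) (1 / t)) => //.
    - by apply: divr_ge0; lra.
    - by apply: divr_ge0; lra.
    - by field.
    - rewrite cE; case: (pos d a) (pos d b) => a1 a2 [b1 b2].
      by congr pair; rewrite /= /GRing.scale /=; field.
  by case/(curve_vertex ac) => /ne; [apply|apply].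
have : curve d a b (pos d c).
  by apply: curve_convex_comb cE => //; lra.
by case/(curve_vertex ab) => /ne; [apply|apply].
Qed.

Lemma curve_drawing_set (R : realType) (G : sgraph) (d : drawing R G) (u v : G) z :
  adj u v -> curve d u v z -> drawing_set d z.
Proof. by move=> uv uvz; right; exists u, v. Qed.

(* A cell avoids the three sides, so its trace on the closed triangle equals its
   trace on the open one: both open and closed in the cell. *)
Lemma outer_open_triangle (R : realType) (G : sgraph) (d : drawing R G) (a b c x : G) :
  straight_line d -> outer d -> adj a b -> adj b c -> adj a c ->
  ~ open_triangle (pos d a) (pos d b) (pos d c) (pos d x).
Proof.
move=> dS [C [[z0 _ Cz0] Cunb Cv]] ab bc ac xT; apply: Cunb.
have D0 := cross_triangle_neq0 dS ab bc ac.
have Cd z : C z -> ~ drawing_set d z.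
  by rewrite Cz0; exact: connected_component_sub.
have CT : C `&` closed_triangle (pos d a) (pos d b) (pos d c) =
          C `&` open_triangle (pos d a) (pos d b) (pos d c).
  apply/seteqP; split=> z [Cz zT]; split=> //; last by case: zT => *; split; apply: ltW.
  have [[[ka kb] kc] /= [k1 zE za zb zc]] := barycentric z D0.
  have D2 : 0 < cross (pos d a) (pos d b) (pos d c) * cross (pos d a) (pos d b) (pos d c).
    by rewrite -expr2 exprn_even_gt0.
  move: zT; rewrite /closed_triangle /open_triangle /= za zb zc -!mulrA.
  rewrite !pmulr_lge0 // !(pmulr_lgt0 _ D2) => -[a0 b0 c0].
  split; rewrite lt_neqAle ?a0 ?b0 ?c0 andbT eq_sym; apply/eqP => e;
    apply: (Cd z Cz).
  - apply: (curve_drawing_set bc); apply: (curve_convex_comb dS bc b0 c0); first by lra.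
    by rewrite zE e scale0r add0r.
  - apply: (curve_drawing_set ac); apply: (curve_convex_comb dS ac a0 c0); first by lra.
    by rewrite zE e scale0r addr0.
  - apply: (curve_drawing_set ab); apply: (curve_convex_comb dS ab a0 b0); first by lra.
    by rewrite zE e scale0r addr0.
apply: (bounded_closed_triangle D0).
have <- : C `&` closed_triangle (pos d a) (pos d b) (pos d c) = C.
  have Ccon : connected C by rewrite Cz0; exact: component_connected.
  apply: Ccon.
  (* The open triangle is a neighbourhood of [x], which is in the closure of the unbounded cell, so
     the trace is nonempty. *)
  - rewrite CT; apply: (Cv x); apply: open_nbhs_nbhs; split=> //.
    exact: open_open_triangle.
  - by exists (open_triangle (pos d a) (pos d b) (pos d c)) => //; exact: open_open_triangle.
  - by exists (closed_triangle (pos d a) (pos d b) (pos d c)) => //; exact: closed_closed_triangle.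
by move=> z [].
Qed.

(** Extends [outer_open_triangle] to the closed triangle: a zero coordinate would put [x] on a side,
    against [curve_vertex]. *)
Lemma outer_triangle_vertex (R : realType) (G : sgraph) (d : drawing R G)
    (a b c x : G) (ka kb kc : R) :
  straight_line d -> outer d -> adj a b -> adj b c -> adj a c ->
  x \notin [:: a; b; c] -> ka + kb + kc = 1 ->
  pos d x = ka *: pos d a + kb *: pos d b + kc *: pos d c ->
  0 <= ka -> 0 <= kb -> 0 <= kc -> False.
Proof.
move=> dS dO ab bc ac; rewrite !inE !negb_or => /and3P[xa xb xc] k1 xE a0 b0 c0.
have D0 := cross_triangle_neq0 dS ab bc ac.
have [e|ea] := eqVneq ka 0.
  have /(curve_vertex bc) : curve d b c (pos d x).
    by apply: (curve_convex_comb dS bc b0 c0); [lra|rewrite xE e scale0r add0r].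
  by case=> /eqP; rewrite ?(negPf xb) ?(negPf xc).
have [e|eb] := eqVneq kb 0.
  have /(curve_vertex ac) : curve d a c (pos d x).
    by apply: (curve_convex_comb dS ac a0 c0); [lra|rewrite xE e scale0r addr0].
  by case=> /eqP; rewrite ?(negPf xa) ?(negPf xc).
have [e|ec] := eqVneq kc 0.
  have /(curve_vertex ab) : curve d a b (pos d x).
    by apply: (curve_convex_comb dS ab a0 b0); [lra|rewrite xE e scale0r addr0].
  by case=> /eqP; rewrite ?(negPf xa) ?(negPf xb).
apply: (@outer_open_triangle _ _ d a b c x) => //.
have D2 : 0 < cross (pos d a) (pos d b) (pos d c) * cross (pos d a) (pos d b) (pos d c).
  by rewrite -expr2 exprn_even_gt0.
have kaE : ka = 1 - kb - kc by lra.
have -> : pos d x = (ka *: pos d a + kb *: pos d b + kc *: pos d c) by [].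
have Ea : cross (ka *: pos d a + kb *: pos d b + kc *: pos d c) (pos d b) (pos d c) =
   ka * cross (pos d a) (pos d b) (pos d c).
  by rewrite kaE /cross /= /GRing.scale /=; ring.
have Eb : cross (pos d a) (ka *: pos d a + kb *: pos d b + kc *: pos d c) (pos d c) =
   kb * cross (pos d a) (pos d b) (pos d c).
  by rewrite kaE /cross /= /GRing.scale /=; ring.
have Ec : cross (pos d a) (pos d b) (ka *: pos d a + kb *: pos d b + kc *: pos d c) =
   kc * cross (pos d a) (pos d b) (pos d c).
  by rewrite kaE /cross /= /GRing.scale /=; ring.
by rewrite /open_triangle /= Ea Eb Ec -!mulrA !(pmulr_lgt0 _ D2) !lt0r ea eb ec.
Qed.

(** * Right-angle crossings with the sides of a triangle *)

(** A common point of two edges without common end is a genuine crossing: by [curve_vertex], a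
    vertex on both would be an end of both. *)
Lemma crossing_perp (R : realType) (G : sgraph) (d : drawing R G) (b c x y : G) z :
  right_angle_crossings d -> adj b c -> adj x y ->
  x \notin [:: b; c] -> y \notin [:: b; c] -> curve d b c z -> curve d x y z ->
  dot (pos d c - pos d b) (pos d y - pos d x) = 0.
Proof.
rewrite !inE !negb_or => dR bc xy /andP[xb xc] /andP[yb yc] zbc zxy.
apply: (dR b c x y z); split=> //.
  apply/eqP => /setP /(_ b); rewrite !inE eqxx /= => /esym /orP[].
    by rewrite eq_sym (negPf xb).
  by rewrite eq_sym (negPf yb).
move=> w zw; move: zbc zxy; rewrite zw => /(curve_vertex bc) wbc /(curve_vertex xy) wxy.
by case: wbc wxy => -> [] e; move: xb xc yb yc; rewrite -e eqxx.
Qed.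

(** Two sides of a nondegenerate triangle are linearly independent; [e1] and [e2] solve the linear
    system by Cramer's rule. *)
Lemma perp_sides_eq0 (R : realType) (a b c v : plane R) :
  cross a b c != 0 -> dot (c - b) v = 0 -> dot (c - a) v = 0 -> v = 0.
Proof.
case: a b c v => [a1 a2] [b1 b2] [c1 c2] [v1 v2]; rewrite /cross /dot /= => D0 p q.
have e1 : v1 * ((b1 - a1) * (c2 - a2) - (b2 - a2) * (c1 - a1)) = 0.
  transitivity (((c1 - a1) * v1 + (c2 - a2) * v2) * (c2 - b2)
    - ((c1 - b1) * v1 + (c2 - b2) * v2) * (c2 - a2)); first by ring.
  by rewrite p q !mul0r subr0.
have e2 : v2 * ((b1 - a1) * (c2 - a2) - (b2 - a2) * (c1 - a1)) = 0.
  transitivity (((c1 - b1) * v1 + (c2 - b2) * v2) * (c1 - a1)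
    - ((c1 - a1) * v1 + (c2 - a2) * v2) * (c1 - b1)); first by ring.
  by rewrite p q !mul0r subr0.
move/eqP: e1 e2; rewrite mulf_eq0 (negPf D0) orbF => /eqP ->.
by move/eqP; rewrite mulf_eq0 (negPf D0) orbF => /eqP ->.
Qed.

(* Walking from [z] on [bc] towards [x], the second barycentric coordinate
   vanishes first, so [xy] leaves the triangle through [ac]; it would be
   perpendicular to both [bc] and [ac]. *)
Lemma crossing_two_sides (R : realType) (G : sgraph) (d : drawing R G)
    (a b c x y : G) z (m n ka kb kc : R) :
  straight_line d -> right_angle_crossings d ->
  adj a b -> adj b c -> adj a c -> adj x y ->
  x \notin [:: a; b; c] -> y \notin [:: a; b; c] ->
  curve d b c z -> curve d x y z ->
  0 < m -> 0 < n -> m + n = 1 -> z = m *: pos d b + n *: pos d c ->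
  0 < ka -> ka + kb + kc = 1 ->
  pos d x = ka *: pos d a + kb *: pos d b + kc *: pos d c ->
  kb < 0 -> n * kb <= m * kc -> False.
Proof.
move=> dS dR ab bc ac xy xabc yabc zbc zxy m0 n0 mn zE ka0 k1 xE kb0 lt.
have [xa xb xc] : [/\ x != a, x != b & x != c].
  by move: xabc; rewrite !inE !negb_or => /and3P[].
have [ya yb yc] : [/\ y != a, y != b & y != c].
  by move: yabc; rewrite !inE !negb_or => /and3P[].
have perp_bc : dot (pos d c - pos d b) (pos d y - pos d x) = 0.
  by apply: (crossing_perp dR bc xy _ _ zbc zxy); rewrite !inE negb_or ?xb ?xc ?yb ?yc.
have on_xy s : 0 <= s -> s <= 1 -> curve d x y ((1 - s) *: z + s *: pos d x).
  move=> s0 s1; have [[p q] /= [p0 q0 pq ze]] := curveP dS xy zxy.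
  apply: (curve_convex_comb (s := (1 - s) * p + s) (t := (1 - s) * q) dS xy).
  - by apply: addr_ge0 => //; apply: mulr_ge0; lra.
  - by apply: mulr_ge0; lra.
  - have -> : q = 1 - p by lra.
    by ring.
  - rewrite ze; case: (pos d x) (pos d y) => x1 x2 [y1 y2].
    by congr pair; rewrite /= /GRing.scale /=; ring.
have mk : m - kb != 0 by apply/eqP; lra.
(* The parameter [s = m / (m - kb)] solves [(1 - s) * m + s * kb = 0], where the coordinate of [b]
   vanishes; that of [c] is then nonnegative by [lt]. *)
have wac : curve d a c ((1 - m / (m - kb)) *: z + (m / (m - kb)) *: pos d x).
  apply: (curve_convex_comb (s := m * ka / (m - kb))
    (t := (m * kc - n * kb) / (m - kb)) dS ac).
  - by apply: divr_ge0; last lra; apply: mulr_ge0; lra.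
  - by apply: divr_ge0; lra.
  - have -> : n = 1 - m by lra.
    have -> : ka = 1 - kb - kc by lra.
    by field.
  - rewrite xE zE; case: (pos d a) (pos d b) (pos d c) => a1 a2 [b1 b2] [c1 c2].
    by congr pair; rewrite /= /GRing.scale /=; field.
have perp_ac : dot (pos d c - pos d a) (pos d y - pos d x) = 0.
  apply: (crossing_perp dR ac xy _ _ wac); rewrite ?inE ?negb_or ?xa ?xc ?ya ?yc //.
  apply: on_xy; first by apply: divr_ge0; lra.
  by rewrite ler_pdivrMr; lra.
have := perp_sides_eq0 (cross_triangle_neq0 dS ab bc ac) perp_bc perp_ac.
by move/subr0_eq/pos_inj => e; move: xy; rewrite e adj_irrefl.
Qed.

(** Since [x] is on the side of [a] but not in the triangle, the edge from [z] to [x] must leave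
    through [ab] or [ac], and [crossing_two_sides] applies up to exchanging [b] and [c]. *)
Lemma crossing_towards_apex (R : realType) (G : sgraph) (d : drawing R G)
    (a b c x y : G) z (ka kb kc : R) :
  straight_line d -> right_angle_crossings d -> outer d ->
  adj a b -> adj b c -> adj a c -> adj x y ->
  x \notin [:: a; b; c] -> y \notin [:: a; b; c] ->
  curve d b c z -> curve d x y z -> 0 < ka -> ka + kb + kc = 1 ->
  pos d x = ka *: pos d a + kb *: pos d b + kc *: pos d c -> False.
Proof.
move=> dS dR dO ab bc ac xy xabc yabc zbc zxy ka0 k1 xE.
have [[m n] /= [m0 n0 mn zE]] := curveP dS bc zbc.
have [xb xc] : x != b /\ x != c.
  by move: xabc; rewrite !inE !negb_or => /and3P[].
have [yb yc] : y != b /\ y != c.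
  by move: yabc; rewrite !inE !negb_or => /and3P[].
(* The point [z] is neither [b] nor [c], as [xy] contains no vertex besides its ends. *)
have {}m0 : 0 < m.
  rewrite lt_neqAle m0 andbT eq_sym; apply/eqP => e.
  move: zxy; rewrite zE e (_ : n = 1) ?scale0r ?scale1r ?add0r; last lra.
  by move/(curve_vertex xy) => -[] /eqP; rewrite eq_sym ?(negPf xc) ?(negPf yc).
have {}n0 : 0 < n.
  rewrite lt_neqAle n0 andbT eq_sym; apply/eqP => e.
  move: zxy; rewrite zE e (_ : m = 1) ?scale0r ?scale1r ?addr0; last lra.
  by move/(curve_vertex xy) => -[] /eqP; rewrite eq_sym ?(negPf xb) ?(negPf yb).
have not_inside : ~ (0 <= kb /\ 0 <= kc).
  by case=> b0 c0; apply: (outer_triangle_vertex dS dO ab bc ac xabc k1 xE); lra.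
(* The comparison tells which coordinate, that of [b] or that of [c], vanishes first on the way from
   [z] to [x]. *)
have [le|lt] := leP (n * kb) (m * kc).
  apply: (crossing_two_sides dS dR ab bc ac xy xabc yabc zbc zxy m0 n0 mn zE ka0 k1 xE) => //.
  rewrite ltNge; apply/negP => kb0; apply: not_inside; split => //.
  by rewrite -(pmulr_rge0 _ m0); apply: le_trans le; apply: mulr_ge0; lra.
have cb : adj c b by rewrite adj_sym.
have xacb : x \notin [:: a; c; b] by move: xabc; rewrite !inE (orbC (x == b)).
have yacb : y \notin [:: a; c; b] by move: yabc; rewrite !inE (orbC (y == b)).
rewrite (curve_sym d bc) in zbc.
rewrite addrC in mn; rewrite addrC in zE.
have {}k1 : ka + kc + kb = 1 by lra.
rewrite addrAC in xE.
apply: (crossing_two_sides dS dR ac cb ab xy xacb yacb zbc zxy n0 m0 mn zE ka0 k1 xE);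
  last exact: ltW.
rewrite ltNge; apply/negP => kc0; apply: not_inside; split => //.
by rewrite -(pmulr_rge0 _ n0); apply: le_trans (ltW lt); apply: mulr_ge0; lra.
Qed.

(** If neither end of [xy] is strictly on the side of [a], then [xy] can meet the line [bc] only by
    lying on it, and it cannot also be perpendicular to [bc]. *)
Lemma edge_not_crossing_triangle (R : realType) (G : sgraph) (d : drawing R G)
    (a b c x y : G) z :
  straight_line d -> right_angle_crossings d -> outer d ->
  adj a b -> adj b c -> adj a c -> adj x y ->
  x \notin [:: a; b; c] -> y \notin [:: a; b; c] ->
  curve d b c z -> curve d x y z -> False.
Proof.
move=> dS dR dO ab bc ac xy xabc yabc zbc zxy.
have D0 := cross_triangle_neq0 dS ab bc ac.
have [xb xc] : x != b /\ x != c.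
  by move: xabc; rewrite !inE !negb_or => /and3P[].
have [yb yc] : y != b /\ y != c.
  by move: yabc; rewrite !inE !negb_or => /and3P[].
have [[[xka xkb] xkc] /= [x1 xE xa _ _]] := barycentric (pos d x) D0.
have [[[yka ykb] ykc] /= [y1 yE ya _ _]] := barycentric (pos d y) D0.
have [x0|x0] := ltP 0 xka.
  exact: (crossing_towards_apex dS dR dO ab bc ac xy xabc yabc zbc zxy x0 x1 xE).
have [y0|y0] := ltP 0 yka.
  have yx : adj y x by rewrite adj_sym.
  have zyx : curve d y x z by rewrite (curve_sym d yx).
  exact: (crossing_towards_apex dS dR dO ab bc ac yx yabc xabc zbc zyx y0 y1 yE).
have [[p q] /= [p0 q0 pq zpq]] := curveP dS xy zxy.
have [[m n] /= [m0 n0 mn zmn]] := curveP dS bc zbc.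
have {}p0 : 0 < p.
  rewrite lt_neqAle p0 andbT eq_sym; apply/eqP => e.
  move: zbc; rewrite zpq e (_ : q = 1) ?scale0r ?scale1r ?add0r; last lra.
  by move/(curve_vertex bc) => -[] /eqP; rewrite ?(negPf yb) ?(negPf yc).
have {}q0 : 0 < q.
  rewrite lt_neqAle q0 andbT eq_sym; apply/eqP => e.
  move: zbc; rewrite zpq e (_ : p = 1) ?scale0r ?scale1r ?addr0; last lra.
  by move/(curve_vertex bc) => -[] /eqP; rewrite ?(negPf xb) ?(negPf xc).
(* The coordinate of [a] is affine along [xy] and vanishes at [z]; two nonpositive terms with sum
   zero are both zero. *)
have : (p * xka + q * yka) * cross (pos d a) (pos d b) (pos d c) = 0.
  rewrite mulrDl -!mulrA -xa -ya.
  have <- : cross z (pos d b) (pos d c) = 0.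
    by rewrite zmn (_ : m = 1 - n) /cross /= /GRing.scale /=; [ring|lra].
  by rewrite zpq (_ : p = 1 - q) /cross /= /GRing.scale /=; [ring|lra].
move/eqP; rewrite mulf_eq0 (negPf D0) orbF => /eqP s0.
have x00 : p * xka <= 0 by rewrite pmulr_rle0.
have y00 : q * yka <= 0 by rewrite pmulr_rle0.
have {x00 y00 s0} [xz yz] : p * xka = 0 /\ q * yka = 0 by split; lra.
have {}xz : xka = 0 by apply/eqP; move/eqP: xz; rewrite mulf_eq0 gt_eqF.
have {}yz : yka = 0 by apply/eqP; move/eqP: yz; rewrite mulf_eq0 gt_eqF.
have perp : dot (pos d c - pos d b) (pos d y - pos d x) = 0.
  by apply: (crossing_perp dR bc xy _ _ zbc zxy); rewrite !inE negb_or ?xb ?xc ?yb ?yc.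
have xEb : xkb = 1 - xkc by lra.
have yEb : ykb = 1 - ykc by lra.
(* With both coordinates of [a] zero, [y - x] is [(ykc - xkc)] times [c - b], so perpendicularity
   forces [x] and [y] to coincide. *)
have : (ykc - xkc) * dot (pos d c - pos d b) (pos d c - pos d b) = 0.
  rewrite -perp xE yE xz yz xEb yEb /dot /= /GRing.scale /=; ring.
have ne : pos d c <> pos d b.
  by move/pos_inj => e; move: bc; rewrite e adj_irrefl.
have dn : dot (pos d c - pos d b) (pos d c - pos d b) != 0.
  apply/eqP => /eqP; rewrite /dot -!expr2 paddr_eq0 ?sqr_ge0 // !expf_eq0 /=.
  rewrite !subr_eq0 => /andP[/eqP e1 /eqP e2]; apply: ne.
  by rewrite [LHS]surjective_pairing e1 e2 -surjective_pairing.
move/eqP; rewrite mulf_eq0 (negPf dn) orbF subr_eq0 => /eqP e.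
have /pos_inj exy : pos d x = pos d y by rewrite xE yE xz yz xEb yEb e.
by move: xy; rewrite exy adj_irrefl.
Qed.

(** * Two triangles on a common edge *)

(** If [c] and [c'] were on the same side of [ab], one would lie in the triangle of the other, or
    [bc'] would cross [ac], or [ac'] would cross [bc]. As [bc'] ends at the apex [b] of [abc], the
    crossing is excluded by the other triangle [b'ac] on that side; likewise [a'bc] for [ac']. *)
Lemma triangles_opposite_sides (R : realType) (G : sgraph) (d : drawing R G)
    (a b c a' b' c' : G) :
  straight_line d -> right_angle_crossings d -> outer d ->
  uniq [:: a; b; c; a'; b'; c'] ->
  adj a b -> adj b c -> adj a c -> adj a c' -> adj b c' ->
  adj a' b -> adj a' c -> adj b' a -> adj b' c ->
  cross (pos d a) (pos d b) (pos d c) * cross (pos d a) (pos d b) (pos d c') < 0.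
Proof.
move=> dS dR dO U ab bc ac ac' bc' a'b a'c b'a b'c.
have D0 := cross_triangle_neq0 dS ab bc ac.
have D0' := cross_triangle_neq0 dS ab bc' ac'.
have [[[ka kb] kc] /= [k1 cE _ _ kcE]] := barycentric (pos d c') D0.
rewrite kcE mulrCA -expr2 pmulr_llt0 ?exprn_even_gt0 // ltNge; apply/negP => kc0.
have {}kc0 : 0 < kc.
  (* For [kc = 0] the triangle [abc'] would be degenerate. *)
  by rewrite lt_neqAle kc0 andbT eq_sym; apply: contraNneq D0' => e; rewrite kcE e mul0r.
have ne : [/\ a \notin [:: a'; b; c], c' \notin [:: a'; b; c],
    b \notin [:: b'; a; c], c' \notin [:: b'; a; c] &
    c' \notin [:: a; b; c] /\ c \notin [:: a; b; c']].
  move: U; rewrite /= !inE !negb_or !andbT -!andbA => /and5P[? ? ? ? /and5P[? ? ? ? /and5P[? ? ? ? /and3P[? ? ?]]]].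
  by do !split; apply/and3P; split=> //; rewrite eq_sym.
case: ne => ne1 ne2 ne3 ne4 [ne5 ne6].
have kaE : ka = 1 - kb - kc by lra.
have [a0|a0] := leP 0 ka.
  have [b0|b0] := leP 0 kb.
    exact: (outer_triangle_vertex dS dO ab bc ac ne5 k1 cE a0 b0 (ltW kc0)).
  have n0 : 1 - kb != 0 by apply/eqP; lra.
  (* Moving the negative term [kb] of [cE] to the other side and normalising by [1 - kb] gives a
     common point of [ac] and [bc']. *)
  have zac : curve d a c ((1 / (1 - kb)) *: pos d c' + (- kb / (1 - kb)) *: pos d b).
    apply: (curve_convex_comb (s := ka / (1 - kb)) (t := kc / (1 - kb)) dS ac).
    - by apply: divr_ge0; lra.
    - by apply: divr_ge0; lra.
    - by rewrite kaE; field.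
    - rewrite cE; case: (pos d a) (pos d b) (pos d c) => a1 a2 [b1 b2] [c1 c2].
      by congr pair; rewrite /= /GRing.scale /=; field.
  have zbc' : curve d b c' ((1 / (1 - kb)) *: pos d c' + (- kb / (1 - kb)) *: pos d b).
    apply: (curve_convex_comb (s := - kb / (1 - kb)) (t := 1 / (1 - kb)) dS bc').
    - by apply: divr_ge0; lra.
    - by apply: divr_ge0; lra.
    - by field.
    - by rewrite addrC.
  exact: (edge_not_crossing_triangle dS dR dO b'a ac b'c bc' ne3 ne4 zac zbc').
have [b0|b0] := leP kb 0.
  have nc : kc != 0 by rewrite gt_eqF.
  (* Solving [cE] for [pos d c] shows that [c] lies in the triangle [abc']. *)
  apply: (outer_triangle_vertex dS dO ab bc' ac' ne6
    (ka := - ka / kc) (kb := - kb / kc) (kc := 1 / kc)).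
  - by rewrite kaE; field.
  - rewrite cE; case: (pos d a) (pos d b) (pos d c) => a1 a2 [b1 b2] [c1 c2].
    by congr pair; rewrite /= /GRing.scale /=; field.
  - by apply: divr_ge0; lra.
  - by apply: divr_ge0; lra.
  - by apply: divr_ge0; lra.
have n0 : 1 - ka != 0 by apply/eqP; lra.
have zbc : curve d b c ((1 / (1 - ka)) *: pos d c' + (- ka / (1 - ka)) *: pos d a).
  apply: (curve_convex_comb (s := kb / (1 - ka)) (t := kc / (1 - ka)) dS bc).
  - by apply: divr_ge0; lra.
  - by apply: divr_ge0; lra.
  - have -> : kb = 1 - ka - kc by lra.
    by field.
  - rewrite cE; case: (pos d a) (pos d b) (pos d c) => a1 a2 [b1 b2] [c1 c2].
    by congr pair; rewrite /= /GRing.scale /=; field.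
have zac' : curve d a c' ((1 / (1 - ka)) *: pos d c' + (- ka / (1 - ka)) *: pos d a).
  apply: (curve_convex_comb (s := - ka / (1 - ka)) (t := 1 / (1 - ka)) dS ac').
  - by apply: divr_ge0; lra.
  - by apply: divr_ge0; lra.
  - by field.
  - by rewrite addrC.
exact: (edge_not_crossing_triangle dS dR dO a'b bc a'c ac' ne1 ne2 zbc zac').
Qed.

(** * The octahedron has no outer-RAC drawing *)

(* The octahedron graph [K_{2,2,2}]; antipodal vertices differ in the second
   component only. *)
Definition octahedron : sgraph :=
  @SGraph ('I_3 * bool)%type (fun u v => u.1 != v.1)
    (fun u v => congr1 negb (eq_sym u.1 v.1))
    (fun u => congr1 negb (eqxx u.1)).

Lemma octahedron_opposite_sides (R : realType) (d : drawing R octahedron)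
    (i j k : 'I_3) (p q r : bool) :
  straight_line d -> right_angle_crossings d -> outer d -> uniq [:: i; j; k] ->
  cross (pos d (i, p)) (pos d (j, q)) (pos d (k, r)) *
  cross (pos d (i, p)) (pos d (j, q)) (pos d (k, ~~ r)) < 0.
Proof.
rewrite /= !inE negb_or !andbT => dS dR dO /andP[/andP[ij ik] jk].
have ji : j != i by rewrite eq_sym.
have ki : k != i by rewrite eq_sym.
have kj : k != j by rewrite eq_sym.
apply: (@triangles_opposite_sides _ octahedron d (i, p) (j, q) (k, r)
  (i, ~~ p) (j, ~~ q) (k, ~~ r)) => //.
rewrite /= !inE !xpair_eqE !negb_or !negb_and !(ij, ik, jk, ji, ki, kj) /= !eqxx /=.
by case: (p) (q) (r) => [] [] [].
Qed.

(** [cross a b c] is a sum of one bilinear term per oriented edge, and each edge occurs in two faces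
    with opposite signs. *)
Lemma alternating_cross_sum (R : realType) (a a' b b' c c' : plane R) :
  cross a b c - cross a b c' - cross a b' c + cross a b' c'
  - cross a' b c + cross a' b c' + cross a' b' c - cross a' b' c' = 0.
Proof. by rewrite /cross; ring. Qed.

Lemma octahedron_not_outer_RAC (R : realType) : ~ outer_RAC R octahedron.
Proof.
case=> d [dS dR dO].
pose i : 'I_3 := Ordinal (isT : (0 < 3)%N); pose j : 'I_3 := Ordinal (isT : (1 < 3)%N).
pose k : 'I_3 := Ordinal (isT : (2 < 3)%N).
pose f p q r := cross (pos d (i, p)) (pos d (j, q)) (pos d (k, r)).
have fk p q r : f p q r * f p q (~~ r) < 0 by exact: octahedron_opposite_sides.
have fj p q r : f p q r * f p (~~ q) r < 0.
  by rewrite /f !(cross_cyclic (pos d (k, r))); exact: octahedron_opposite_sides.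
have fi p q r : f p q r * f (~~ p) q r < 0.
  by rewrite /f -(cross_cyclic (pos d (i, p))) -(cross_cyclic (pos d (i, ~~ p))); exact: octahedron_opposite_sides.
have := alternating_cross_sum (pos d (i, true)) (pos d (i, false))
  (pos d (j, true)) (pos d (j, false)) (pos d (k, true)) (pos d (k, false)).
rewrite -/(f true true true) -/(f true true false) -/(f true false true)
  -/(f true false false) -/(f false true true) -/(f false true false)
  -/(f false false true) -/(f false false false).
(* These seven sign changes form a spanning tree of the cube of the eight faces, so the sign of
   [f true true true] determines all the others. *)
have e1 := fk true true true; have e2 := fk true false true.
have e3 := fk false true true; have e4 := fk false false true.
have e5 := fj true true true; have e6 := fj false true true.
have e7 := fi true true true; move: e1 e2 e3 e4 e5 e6 e7 => /=.
have [t0|t0|->] := ltgtP (f true true true) 0; last by rewrite mul0r ltxx.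
  rewrite !(nmulr_rlt0 _ t0) => e1 e2 e3 e4 e5 e6 e7.
  move: e2 e3 e4 e6; rewrite !(pmulr_rlt0 _ e5) !(pmulr_rlt0 _ e7) => e2 e3 e4 e6.
  by move: e4; rewrite (nmulr_rlt0 _ e6); lra.
rewrite !(pmulr_rlt0 _ t0) => e1 e2 e3 e4 e5 e6 e7.
move: e2 e3 e4 e6; rewrite !(nmulr_rlt0 _ e5) !(nmulr_rlt0 _ e7) => e2 e3 e4 e6.
by move: e4; rewrite (pmulr_rlt0 _ e6); lra.
Qed.

(** * Degrees and connectivity of the octahedron *)

Lemma octahedron_neighbours (u : octahedron) : #|[set w : octahedron | adj u w]%SET| = 4%N.
Proof.
have -> : [set w : octahedron | adj u w]%SET = (~: [set u; (u.1, ~~ u.2)])%SET.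
  apply/setP => -[i p]; case: u => [j q]; rewrite !inE /= !xpair_eqE.
  by rewrite (eq_sym i j); case: (j == i) => //=; case: p q => -[].
rewrite cardsCs finset.setCK cards2 card_prod card_ord card_bool.
by case: u => i []; rewrite xpair_eqE /= andbF.
Qed.

Lemma octahedron_max_degree : max_degree octahedron = 4%N.
Proof.
apply/eqP; rewrite eqn_leq; apply/andP; split.
  by apply/bigmax_leqP => u _; rewrite /degree octahedron_neighbours.
rewrite -(octahedron_neighbours (ord0, true)) -/(degree _).
exact: (leq_bigmax (F := @degree octahedron)).
Qed.

(** Vertices with distinct indices are adjacent; those with the same index share their four
    neighbours, of which [S] contains at most two. *)
Lemma octahedron_triconnected : triconnected octahedron.
Proof.
split; first by rewrite card_prod card_ord card_bool.
move=> S S3 x y xS yS.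
have /subsetPn[w] : ~~ ([set w | adj x w] \subset S)%SET.
  apply: contraTN S3 => /subset_leq_card; rewrite octahedron_neighbours -leqNgt.
  exact: ltnW.
rewrite inE => xw wS.
have [xy|xy] := eqVneq x.1 y.1.
  apply: (@connect_trans _ _ w); apply: connect1; rewrite /adj_avoiding /= ?xS ?yS ?wS //=.
  by rewrite -xy eq_sym.
by apply: connect1; rewrite /adj_avoiding /= xS yS.
Qed.

(** * A crossing-free drawing of the octahedron *)

Lemma segment_arc (R : realType) (p q : plane R) :
  p <> q -> simple_arc p q (segment p q).
Proof.
move=> pq; exists (fun t : R => (1 - t) *: p + t *: q); split=> //.
- apply: continuous_subspaceT => t; apply: cvgD; apply: cvgZr_tmp.
    by apply: cvgB; [exact: cvg_cst|exact: cvg_id].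
  exact: cvg_id.
- move=> s t _ _; case: p q pq => [p1 p2] [q1 q2] pq.
  move/eqP; rewrite -subr_eq0 => /eqP -[]; rewrite /= /GRing.scale /= => e1 e2.
  apply/eqP; rewrite -subr_eq0; apply/negP => /negP st; apply: pq.
  have f1 : (s - t) * (q1 - p1) = 0 by lra.
  have f2 : (s - t) * (q2 - p2) = 0 by lra.
  move/eqP: f1 f2; rewrite mulf_eq0 (negPf st) subr_eq0 => /eqP ->.
  by move/eqP; rewrite mulf_eq0 (negPf st) subr_eq0 => /eqP ->.
- by rewrite subr0 scale1r scale0r addr0.
- by rewrite subrr scale1r scale0r add0r.
Qed.

Lemma segment_sym (R : realType) (p q : plane R) : segment p q = segment q p.
Proof.
suff sub (u v : plane R) : segment u v `<=` segment v u by apply/seteqP.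
move=> z [t /=]; rewrite in_itv /= => /andP[t0 t1] <-.
exists (1 - t); last by rewrite addrC subKr.
by rewrite /= in_itv /=; apply/andP; split; lra.
Qed.

Lemma cross_segment (R : realType) (p q u v z : plane R) (t : R) :
  z = (1 - t) *: u + t *: v -> cross p q z = (1 - t) * cross p q u + t * cross p q v.
Proof. by move=> ->; rewrite /cross /= /GRing.scale /=; ring. Qed.

(** Along [uv] the function [cross p q] is affine, and its end values have weakly equal signs and
    are not both zero; it can vanish only at an end. *)
Lemma segments_disjoint (R : realType) (p q u v z : plane R) :
  0 <= cross p q u * cross p q v -> (cross p q u != 0) || (cross p q v != 0) ->
  segment p q z -> segment u v z -> z = u \/ z = v.
Proof.
move=> sgn nz [t _ tz] [s /=]; rewrite in_itv /= => /andP[s0 s1] sz.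
have : cross p q z = 0 by rewrite -tz /cross /= /GRing.scale /=; ring.
rewrite (cross_segment _ _ (esym sz)); move: (cross p q u) (cross p q v) sgn nz => x y xy nz e.
case/orP: nz => [x0|y0]; [right|left]; rewrite -sz.
  suff -> : s = 1 by rewrite subrr scale0r scale1r add0r.
  have x2 : 0 < x ^+ 2 by rewrite exprn_even_gt0.
  (* Multiplying [e] by [x] makes both of its terms nonnegative. *)
  have e' : (1 - s) * x ^+ 2 = - (s * (x * y)).
    by transitivity (x * ((1 - s) * x + s * y) - s * (x * y)); [ring|rewrite e; ring].
  have : (1 - s) * x ^+ 2 <= 0 by rewrite e' oppr_le0 mulr_ge0.
  by rewrite pmulr_lle0 //; lra.
suff -> : s = 0 by rewrite subr0 scale0r scale1r addr0.
have y2 : 0 < y ^+ 2 by rewrite exprn_even_gt0.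
have e' : s * y ^+ 2 = - ((1 - s) * (x * y)).
  by transitivity (y * ((1 - s) * x + s * y) - (1 - s) * (x * y)); [ring|rewrite e; ring].
have : s * y ^+ 2 <= 0 by rewrite e' oppr_le0 mulr_ge0 ?subr_ge0.
by rewrite pmulr_lle0 //; lra.
Qed.

(** A triangle nested in another: the [false] vertices are the outer corners, the [true] ones lie
    inside. Integer coordinates make all checks computable; the wildcard stands for index 2. *)
Definition octa_coord (k : nat * bool) : int * int :=
  match k with
  | (0%N, false) => (0, 0)
  | (1%N, false) => (4, 0)
  | (_, false) => (0, 4)
  | (0%N, true) => (2, 1)
  | (1%N, true) => (1, 2)
  | (_, true) => (1, 1)
  end.

Definition octa_cross (u v w : nat * bool) : int :=
  let a := octa_coord u in let b := octa_coord v in let c := octa_coord w in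
  (b.1 - a.1) * (c.2 - a.2) - (b.2 - a.2) * (c.1 - a.1).

Definition octa_codes : seq (nat * bool) :=
  [seq (i, b) | i <- iota 0 3, b <- [:: false; true]].

(** The hypotheses of [segments_disjoint] in integer form. *)
Definition octa_separated (u v x y : nat * bool) : bool :=
  (0 <= octa_cross u v x * octa_cross u v y) &&
  ((octa_cross u v x != 0) || (octa_cross u v y != 0)).

(** Gives both the injectivity of the positions and the absence of a third vertex on an edge. *)
Lemma octa_general_position :
  all (fun u => all (fun v => all (fun w =>
    uniq [:: u; v; w] ==> (octa_cross u v w != 0)) octa_codes) octa_codes) octa_codes.
Proof. by vm_compute. Qed.

(** Either edge may be the one whose line separates. Edges with a common end are covered too: one of
    the two values is zero and the other is not. *)
Lemma octa_noncrossing :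
  all (fun u => all (fun v => all (fun x => all (fun y =>
    [&& u.1 != v.1, x.1 != y.1 & ~~ (((u == x) && (v == y)) || ((u == y) && (v == x)))] ==>
    octa_separated u v x y || octa_separated x y u v)
  octa_codes) octa_codes) octa_codes) octa_codes.
Proof. by vm_compute. Qed.

(* [octa_coord] and the checks by computation work on codes in [nat * bool],
   which, unlike ordinals, carry no proofs. *)
Definition octa_code (u : octahedron) : nat * bool := (val u.1, u.2).

Lemma octa_code_inj : injective octa_code.
Proof. by move=> [i p] [j q] [/val_inj -> ->]. Qed.

Lemma octa_codeP (u : octahedron) : octa_code u \in octa_codes.
Proof. by case: u => -[[|[|[|m]]] lt_m] []. Qed.

Definition octa_pos (R : realType) (u : octahedron) : plane R :=
  ((octa_coord (octa_code u)).1%:~R, (octa_coord (octa_code u)).2%:~R).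

Lemma octa_posE (R : realType) (u v w : octahedron) :
  cross (octa_pos R u) (octa_pos R v) (octa_pos R w) =
  (octa_cross (octa_code u) (octa_code v) (octa_code w))%:~R.
Proof. by rewrite /cross /octa_cross /= !(rmorphB, rmorphM). Qed.

Lemma octa_cross_neq0 (R : realType) (u v w : octahedron) :
  uniq [:: u; v; w] -> cross (octa_pos R u) (octa_pos R v) (octa_pos R w) != 0.
Proof.
rewrite octa_posE intr_eq0 -(map_inj_uniq octa_code_inj) /=.
by move: octa_general_position => /allP/(_ _ (octa_codeP u))/allP/(_ _ (octa_codeP v))
  /allP/(_ _ (octa_codeP w))/implyP.
Qed.

(** Two coinciding vertices would be collinear with any third one. *)
Lemma octa_pos_inj (R : realType) : injective (@octa_pos R).
Proof.
move=> u v; case: (eqVneq u v) => // uv e.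
have [w wu wv] : exists2 w : octahedron, w != u & w != v.
  have /subsetPn[w _] : ~~ ([set: octahedron] \subset [set u; v])%SET.
    apply: contraTN isT => /subset_leq_card.
    by rewrite cardsT cards2 card_prod card_ord card_bool; case: (u != v).
  by rewrite !inE negb_or => /andP[wu wv]; exists w.
have : uniq [:: u; v; w] by rewrite /= !inE negb_or uv !(eq_sym _ w) wu wv.
by move/(octa_cross_neq0 R); rewrite e /cross !subrr !mul0r subr0 eqxx.
Qed.

Lemma octa_separatedP (R : realType) (u v x y : octahedron) z :
  octa_separated (octa_code u) (octa_code v) (octa_code x) (octa_code y) ->
  segment (octa_pos R u) (octa_pos R v) z -> segment (octa_pos R x) (octa_pos R y) z ->
  exists w, z = octa_pos R w.
Proof.
case/andP => sgn nz uvz xyz.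
have [||->|->] := segments_disjoint _ _ uvz xyz.
- by rewrite !octa_posE -intrM ler0z.
- by rewrite !octa_posE !intr_eq0.
- by exists x.
- by exists y.
Qed.

Lemma octa_segment_vertex (R : realType) (u v w : octahedron) :
  adj u v -> segment (octa_pos R u) (octa_pos R v) (octa_pos R w) -> w = u \/ w = v.
Proof.
move=> uv [t _ tz].
have [->|wu] := eqVneq w u; first by left.
have [->|wv] := eqVneq w v; first by right.
have : uniq [:: u; v; w].
  rewrite /= !inE negb_or !(eq_sym _ w) wu wv !andbT.
  by apply: contraTneq uv => ->; rewrite adj_irrefl.
move/(octa_cross_neq0 R); rewrite -tz => /eqP; case.
by rewrite /cross /= /GRing.scale /=; ring.
Qed.

Lemma octahedron_planar (R : realType) : planar R octahedron.
Proof.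
pose c (u v : octahedron) := segment (octa_pos R u) (octa_pos R v).
have c_sym u v : adj u v -> c u v = c v u by move=> _; exact: segment_sym.
have c_arc u v : adj u v -> simple_arc (octa_pos R u) (octa_pos R v) (c u v).
  move=> uv; apply: segment_arc => /octa_pos_inj e.
  by move: uv; rewrite e adj_irrefl.
exists (Drawing (@octa_pos_inj R) c_sym c_arc (@octa_segment_vertex R)).
move=> u v x y p [uv xy /eqP ne [/= uvp xyp] pw].
have := octa_noncrossing => /allP/(_ _ (octa_codeP u))/allP/(_ _ (octa_codeP v))
  /allP/(_ _ (octa_codeP x))/allP/(_ _ (octa_codeP y))/implyP.
case/(_ _)/orP => [|H|H].
- apply/and3P; split; rewrite // !(inj_eq octa_code_inj).
  apply/negP => /orP[] /andP[/eqP ux /eqP vy]; apply: ne; rewrite ux vy //.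
  exact: finset.setUC.
- by have [w] := octa_separatedP H uvp xyp; exact: pw.
- by have [w] := octa_separatedP H xyp uvp; exact: pw.
Qed.

Local Close Scope ring_scope.
Local Close Scope classical_set_scope.

Theorem theorem5 (R : realType) :
  exists G : sgraph,
    [/\ planar R G, triconnected G, max_degree G = 4 & ~ outer_RAC R G].
Proof.
exists octahedron; split.
- exact: octahedron_planar.
- exact: octahedron_triconnected.
- exact: octahedron_max_degree.
- exact: octahedron_not_outer_RAC.
Qed.
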